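(* For all positive integers $a,b,c$ with $a<b$, $$R_c(a(x-y)=bz)\ge\frac{bc^3}{e(b+3)}+\frac{2b+3}{b+3},$$ where $e$ is the base of the natural logarithm.
   Context: For a positive integer $N$ let $[N]=\{1,\dots,N\}$. For a linear homogeneous equation $\mathcal{E}$ with integer coefficients and a positive integer $c$, the Rado number $R_c(\mathcal{E})$ is the least positive integer $N$ such that every $c$-coloring of $[N]$ contains a monochromatic solution to $\mathcal{E}$, i.e. a solution whose variables all take values in $[N]$ (not necessarily distinct) having the same color. If no such $N$ exists, $R_c(\mathcal{E})=\infty$. *)

(* Defs.v *)
From HB Require Import structures.
From mathcomp Require Import all_boot all_order all_algebra.
From mathcomp Require Import boolp reals ereal.

Set Implicit Arguments.
Unset Strict Implicit.
Unset Printing Implicit Defensive.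

Import Order.TTheory GRing.Theory Num.Theory.

Local Open Scope ring_scope.

(* A linear homogeneous equation E_1 x_1 + ... + E_k x_k = 0 with integer
   coefficients is represented by the tuple E of its coefficients. *)
Definition is_solution (k : nat) (E : k.-tuple int) (x : k.-tuple nat) : Prop :=
  \sum_(i < k) tnth E i * (tnth x i)%:Z = 0.

(* Only the values of the coloring chi on {1, ..., N} are used. *)
Definition monochromatic_solution (c N k : nat) (E : k.-tuple int)
    (chi : nat -> 'I_c) (x : k.-tuple nat) : Prop :=
  [/\ is_solution E x,
      forall i : 'I_k, (1 <= tnth x i <= N)%N &
      forall i j : 'I_k, chi (tnth x i) = chi (tnth x j)].

Definition rado_property (c k : nat) (E : k.-tuple int) (N : nat) : Prop :=
  (0 < N)%N /\
  forall chi : nat -> 'I_c,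
    exists x : k.-tuple nat, monochromatic_solution N E chi x.

Definition rado_number (R : realType) (c k : nat) (E : k.-tuple int) : \bar R :=
  match pselect (exists N : nat, `[< rado_property c E N >]) with
  | left exN => ((ex_minn exN)%:R)%:E
  | right _ => +oo%E
  end.

Definition eq_axy_bz (a b : nat) : 3.-tuple int :=
  [tuple a%:Z; - a%:Z; - b%:Z].

Lemma eq_axy_bzP (a b x y z : nat) :
  is_solution (eq_axy_bz a b) [tuple x; y; z] <->
  a%:Z * (x%:Z - y%:Z) = b%:Z * z%:Z.
Proof.
rewrite /is_solution !big_ord_recl big_ord0 !(tnth_nth (0 : int)) !(tnth_nth 0%N) /=.
rewrite addr0 addrA !mulNr -mulrBr.
by split=> [/eqP|->]; rewrite ?subrr // subr_eq0 => /eqP.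
Qed.

(* Main.v *)
Require Import Defs.
From mathcomp Require Import all_boot all_order all_algebra.
From mathcomp Require Import boolp reals ereal sequences exp.
From mathcomp Require Import zify ring lra.

Import Order.TTheory GRing.Theory Num.Theory.
Local Open Scope ring_scope.

(** Since a < b, every solution of a(x - y) = bz satisfies x > y + z. Hence no
    block {2^k - 1, ..., 2^(k+1) - 2} contains a solution, and giving each of
    the first c blocks its own color shows R_c >= 2^(c+1) - 1. This is at
    least c^3/e + 2, which in turn exceeds the claimed bound. *)

Lemma solution_gt_sum (a b x y z : nat) :
  (a < b)%N -> (0 < z)%N -> is_solution (eq_axy_bz a b) [tuple x; y; z] ->
  (y + z < x)%N.
Proof. by move=> ab z0 /eq_axy_bzP; nia. Qed.

(** If all three logarithms were [k], then [x + 1 >= (y + 1) + (z + 1) >= 2^k + 2^k], against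
    [x + 1 < 2^(k+1)]. *)
Lemma trunc_log2_not_constant {x y z : nat} : (y + z < x)%N ->
  ~ (trunc_log 2 x.+1 = trunc_log 2 y.+1 /\
     trunc_log 2 x.+1 = trunc_log 2 z.+1).
Proof.
move=> yzx [xy xz].
have := trunc_logP (isT : (1 < 2)%N) (ltn0Sn y); rewrite -xy.
have := trunc_logP (isT : (1 < 2)%N) (ltn0Sn z); rewrite -xz.
have := trunc_log_ltn x.+1 (isT : (1 < 2)%N); rewrite expnS; lia.
Qed.

Lemma rado_property_gt {a b c N : nat} : (a < b)%N -> (0 < c)%N ->
  rado_property c (eq_axy_bz a b) N -> (2 ^ c.+1 < N.+2)%N.
Proof.
(* The number [n] lies in block [trunc_log 2 n.+1]; blocks are counted from 1 and colors from 0,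
   hence the predecessor. *)
case: c => // c ab _ [_ /(_ (fun n => inord (trunc_log 2 n.+1).-1))].
case=> -[[|x [|y [|z [|? ?]]]] // sz] [sol rng mono].
rewrite ltnNge; apply/negP => leN.
(* [inord] collapses out-of-range values to 0, so colors determine blocks only because [leN] keeps
   the block index of each point of [[N]] between 1 and the number of colors. *)
have inj n m : (0 < n <= N)%N -> (0 < m <= N)%N ->
    inord (trunc_log 2 n.+1).-1 = inord (trunc_log 2 m.+1).-1 :> 'I_c.+1 ->
    trunc_log 2 n.+1 = trunc_log 2 m.+1.
  have bnd k : (0 < k <= N)%N -> (0 < trunc_log 2 k.+1 < c.+2)%N.
    move=> /andP[k0 kN]; rewrite trunc_log_gt0 /= ltnS k0 /=.
    rewrite -(ltn_exp2l _ _ (isT : (1 < 2)%N)).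
    by apply: leq_ltn_trans (trunc_logP _ _) _ => //; lia.
  move=> /bnd ? /bnd ? /(congr1 val) /=; rewrite !inordK; lia.
have i0 := rng ord0; have i1 := rng (inord 1); have i2 := rng (inord 2).
have m1 := mono ord0 (inord 1); have m2 := mono ord0 (inord 2).
rewrite !(tnth_nth 0%N) !inordK //= in i0 i1 i2 m1 m2.
have sol' : is_solution (eq_axy_bz a b) [tuple x; y; z].
  by rewrite (_ : [tuple x; y; z] = Tuple sz) //; apply: val_inj.
have yzx : (y + z < x)%N by case/andP: (i2) => z0 _; apply: solution_gt_sum sol'.
by apply: (trunc_log2_not_constant yzx); split; apply: inj.
Qed.

(** This is [c^3 <= 9/4 * (2 * 2^c - 3)] with denominators cleared, where 9/4 stands in for [e]. *)
Lemma cube_le_exp2 (c : nat) : (0 < c)%N -> (4 * c ^ 3 + 27 <= 18 * 2 ^ c)%N.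
Proof.
(* Doubling the right side pays for [(c+1)^3 <= 2 * c^3] only from [c = 4] on; smaller values are
   computed. *)
do 4?[case: c => [//|c]]; move=> _; elim: c => [//|c IH].
rewrite expnS; have {IH} : (4 * c.+4 ^ 3 + 27 <= 18 * 2 ^ c.+4)%N := IH.
rewrite !expnS !expn0; nia.
Qed.

(** Square [1 + 1/2 <= expR (1/2)]. The cruder [e >= 2] would not do: at [c = 4],
    [64 > 2 * (2 * 16 - 3)]. *)
Lemma expR1_ge94 (R : realType) : 9 / 4 <= expR 1 :> R.
Proof.
have half : 3 / 2 <= expR 2^-1 :> R by apply: le_trans (expR_ge1Dx _); lra.
rewrite [X in expR X](_ : _ = 2^-1 + 2^-1) ?expRD; last by lra.
by move: (expR _) half => t half; nra.
Qed.

(** The left side is the mean of [c^3/e + 2] and 1 with weights [b] and 3, and neither exceeds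
    [2^(c+1) - 1]. *)
Lemma bound_le_exp2 (R : realType) {b c : nat} : (0 < b)%N -> (0 < c)%N ->
  b%:R * c%:R ^+ 3 / (expR 1 * (b%:R + 3)) + (2 * b%:R + 3) / (b%:R + 3)
    <= 2 ^+ c.+1 - 1 :> R.
Proof.
move=> b0 /cube_le_exp2.
rewrite -(ler_nat R) natrD natrM natrX natrM natrX => cle.
have e94 := expR1_ge94 R; set e := expR 1 in e94 *.
have B0 : 0 < b%:R :> R by rewrite ltr0n.
set B : R := b%:R in B0 *; set C := c%:R ^+ 3 in cle *.
have C0 : 0 <= C by apply: exprn_ge0.
rewrite exprS; set P := 2 ^+ c in cle *.
have Ce : C <= e * (2 * P - 3).
  apply: (@le_trans _ _ (9 / 4 * (2 * P - 3))); first by lra.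
  by apply: ler_wpM2r => //; lra.
have e0 : 0 < e by lra.
have -> : B * C / (e * (B + 3)) + (2 * B + 3) / (B + 3)
          = (B * (C / e) + 2 * B + 3) / (B + 3).
  by field; rewrite !gt_eqF //; lra.
rewrite ler_pdivrMr; last by lra.
have : C / e <= 2 * P - 3 by rewrite ler_pdivrMr // mulrC.
nra.
Qed.

Theorem theorem5p19 (R : realType) (a b c : nat)
    (ha : (0 < a)%N) (hb : (0 < b)%N) (hc : (0 < c)%N) (hab : (a < b)%N) :
  ((b%:R * c%:R ^+ 3 / (expR 1 * (b%:R + 3)) + (2 * b%:R + 3) / (b%:R + 3))%:E
     <= rado_number R c (eq_axy_bz a b))%E.
Proof.
rewrite /rado_number; case: pselect => [exN|_]; last by rewrite leey.
case: ex_minnP => N /asboolP /(rado_property_gt hab hc) ltN _.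
rewrite lee_fin; apply: le_trans (bound_le_exp2 R hb hc) _.
by rewrite lerBlDr -natrX natr1 ler_nat -ltnS.
Qed.
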